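(* Let $F(x,y,z,w)$ denote the generating function for the set of all 021-avoiding ascent sequences (of all lengths, including the empty sequence), where $x,y,z,w$ mark, respectively, length, number of 0's, number of isolated 0's, and number of runs of 2 or more 0's; i.e. $F(x,y,z,w)=\sum_a x^{\mathrm{length}(a)}y^{\#0\text{'s in }a}z^{\#\text{isolated }0\text{'s in }a}w^{\#\text{runs of}\ \ge 2\ 0\text{'s in }a}$, a formal power series in $x$ with coefficients in $\mathbb{Z}[y,z,w]$. Then $$F(x,y,z,w)=\frac{1}{2x}\left(1-\sqrt{\frac{1-x(4+y)+4x^2\bigl(1+y(1-z)\bigr)-4x^3y\bigl(1+wy-(1+y)z\bigr)+4x^4y^2(w-z)}{1-xy}}\right).$$
   Context: An ascent sequence of length $n\ge1$ is a sequence $a_1a_2\dots a_n$ of nonnegative integers with $a_1=0$ and, for each $i\ge 2$, $a_i\le 1+\#\{j\in[1,i-2]: a_j<a_{j+1}\}$; the empty sequence is the ascent sequence of length 0. A sequence avoids 021 if there are no indices $i<j<k$ with $a_i<a_k<a_j$. A run of 0's is a maximal block of consecutive entries all equal to 0; an isolated 0 is a run of 0's of length exactly 1. For example, $00102200023030$ contributes $x^{14}y^8z^3w^2$ to $F$. The square root denotes the formal power series in $x$ with constant term 1. *)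

(* Defs.v *)
From HB Require Import structures.
From mathcomp Require Import all_boot all_order all_algebra.
From mathcomp Require Import mpoly.
From mathcomp Require boolp.

Set Implicit Arguments.
Unset Strict Implicit.
Unset Printing Implicit Defensive.

Import GRing.Theory.
Local Open Scope ring_scope.

(* Words are 0-indexed: the letter a_(i+1) of the word a is [nth 0 a i]. *)

(* [ascents a i] is the number of ascents of the prefix of length i of a. *)
Definition ascents (a : seq nat) (i : nat) : nat :=
  count (fun j => nth 0 a j < nth 0 a j.+1)%N (iota 0 i.-1).

Definition ascent_seq (a : seq nat) : bool :=
  (nth 0 a 0 == 0)%N &&
  [forall i : 'I_(size a), (0 < i)%N ==> (nth 0 a i <= 1 + ascents a i)%N].

Definition avoids021 (a : seq nat) : bool :=
  ~~ [exists i : 'I_(size a), exists j : 'I_(size a), exists k : 'I_(size a),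
       [&& (i < j)%N, (j < k)%N,
           (nth 0 a i < nth 0 a k)%N & (nth 0 a k < nth 0 a j)%N]].

(* The block of l consecutive letters of a starting at position i is a run of
   0's, i.e. a nonempty and maximal block of 0's. *)
Definition zero_run (a : seq nat) (i l : nat) : bool :=
  [&& (0 < l)%N, (i + l <= size a)%N,
      all (fun j => nth 0 a j == 0)%N (iota i l),
      (i == 0)%N || (nth 0 a i.-1 != 0)%N &
      (i + l == size a)%N || (nth 0 a (i + l) != 0)%N].

Definition zeros (a : seq nat) : nat := count_mem 0%N a.

Definition isolated_zeros (a : seq nat) : nat :=
  count (fun i => zero_run a i 1) (iota 0 (size a)).

Definition long_zero_runs (a : seq nat) : nat :=
  count (fun p => zero_run a p.1 p.2)
    [seq (i, l) | i <- iota 0 (size a), l <- iota 2 (size a).-1].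

Example statistics_example :
  let a := [:: 0; 0; 1; 0; 2; 2; 0; 0; 0; 2; 3; 0; 3; 0]%N in
  (size a, zeros a, isolated_zeros a, long_zero_runs a) = (14, 8, 3, 2)%N.
Proof. by []. Qed.

(* An ascent sequence of length n has all its letters smaller than n, so that
   the ascent sequences of length n are the [map val t] for [t : n.-tuple 'I_n]. *)
Lemma ascent_seq_ltn (a : seq nat) :
  ascent_seq a -> all (fun k => k < size a)%N a.
Proof.
case/andP=> /eqP a0 /forallP aP; apply/(all_nthP 0%N) => i lt_i.
case: i lt_i => [|i] lt_i; first by rewrite a0.
have /= := aP (Ordinal lt_i); rewrite /ascents /= => le_i.
apply: leq_ltn_trans le_i _; apply: leq_ltn_trans lt_i.
by rewrite add1n ltnS (leq_trans (count_size _ _)) ?size_iota.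
Qed.

Definition fps (R : Type) : Type := nat -> R.

HB.instance Definition _ (R : Type) := boolp.gen_eqMixin (fps R).
HB.instance Definition _ (R : Type) := boolp.gen_choiceMixin (fps R).

(* [fps_rec step] is the series whose n-th coefficient is [step] applied to the
   sequence of its first n coefficients. *)
Fixpoint fps_prefix (R : Type) (step : seq R -> R) (n : nat) : seq R :=
  if n is m.+1 then rcons (fps_prefix step m) (step (fps_prefix step m))
  else [::].

Definition fps_rec (R : Type) (step : seq R -> R) : fps R :=
  fun n => step (fps_prefix step n).

Lemma fps_prefixE (R : Type) (step : seq R -> R) n :
  fps_prefix step n = mkseq (fps_rec step) n.
Proof. by elim: n => //= n IHn; rewrite mkseqS -IHn. Qed.

Lemma fps_recE (R : Type) (step : seq R -> R) n :
  fps_rec step n = step (mkseq (fps_rec step) n).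
Proof. by rewrite -fps_prefixE. Qed.

Definition fps_map (R S : Type) (h : R -> S) (f : fps R) : fps S :=
  fun n => h (f n).

Section Ring.
Variable R : comNzRingType.
Implicit Types f g h : fps R.

Definition fps_of_poly (p : {poly R}) : fps R := fun n => p`_n.

Definition fps_zero : fps R := fun=> 0.
Definition fps_opp f : fps R := fun n => - f n.
Definition fps_add f g : fps R := fun n => f n + g n.
Definition fps_one : fps R := fun n => (n == 0%N)%:R.
Definition fps_mul f g : fps R := fun n => \sum_(i < n.+1) f i * g (n - i)%N.

Fact fps_addA : associative fps_add.
Proof. by move=> f g h; apply: boolp.funext => n; apply: addrA. Qed.
Fact fps_addC : commutative fps_add.
Proof. by move=> f g; apply: boolp.funext => n; apply: addrC. Qed.
Fact fps_add0 : left_id fps_zero fps_add.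
Proof. by move=> f; apply: boolp.funext => n; apply: add0r. Qed.
Fact fps_addN : left_inverse fps_zero fps_opp fps_add.
Proof. by move=> f; apply: boolp.funext => n; apply: addNr. Qed.

HB.instance Definition _ :=
  GRing.isZmodule.Build (fps R) fps_addA fps_addC fps_add0 fps_addN.

Fact fps_mulE N f g n : (n < N)%N ->
  fps_mul f g n = ((\poly_(i < N) f i) * (\poly_(i < N) g i))`_n.
Proof.
move=> lt_nN; rewrite coefM; apply: eq_bigr => i _; rewrite !coef_poly.
by rewrite (leq_trans (ltn_ord i) lt_nN) (leq_ltn_trans (leq_subr i n) lt_nN).
Qed.

Fact fps_mulC : commutative fps_mul.
Proof.
by move=> f g; apply: boolp.funext => n; rewrite !(fps_mulE _ _ (ltnSn n)) mulrC.
Qed.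

Fact fps_mulA : associative fps_mul.
Proof.
move=> f g h; apply: boolp.funext => n.
set T := fun u : fps R => \poly_(i < n.+1) u i.
transitivity ((T f * (T g * T h))`_n).
  rewrite coefM; apply: eq_bigr => i _.
  rewrite -(fps_mulE (N := n.+1)) ?ltnS ?leq_subr //.
  by rewrite coef_poly ltn_ord.
rewrite mulrA coefM; apply: eq_bigr => i _.
rewrite -(fps_mulE (N := n.+1)) ?ltn_ord //.
by rewrite coef_poly ltnS leq_subr.
Qed.

Fact fps_mul1 : left_id fps_one fps_mul.
Proof.
move=> f; apply: boolp.funext => n; rewrite /fps_mul big_ord_recl subn0 mul1r.
by rewrite big1 ?addr0 // => i _; rewrite mul0r.
Qed.

Fact fps_mulDl : left_distributive fps_mul fps_add.
Proof.
move=> f g h; apply: boolp.funext => n; rewrite /fps_add -big_split.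
by apply: eq_bigr => i _; rewrite mulrDl.
Qed.

Fact fps_oner_neq0 : fps_one != 0 :> fps R.
Proof.
apply/eqP => /(congr1 (fun f : fps R => f 0%N)) /eqP.
by apply/negP; apply: oner_neq0.
Qed.

HB.instance Definition _ :=
  GRing.Zmodule_isComNzRing.Build (fps R)
    fps_mulA fps_mulC fps_mul1 fps_mulDl fps_oner_neq0.

Lemma fps_coefM f g n : (f * g) n = \sum_(i < n.+1) f i * g (n - i)%N.
Proof. by []. Qed.

(* Division by the variable of a series with zero constant term. *)
Definition fps_divX f : fps R := fun n => f n.+1.

Lemma fps_divXK f : f 0%N = 0 -> fps_of_poly 'X * fps_divX f = f.
Proof.
move=> f0; apply: boolp.funext => -[|n]; rewrite fps_coefM.
  by rewrite big_ord1 /fps_of_poly coefX mul0r f0.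
rewrite 2!big_ord_recl big1 ?addr0 => [|i _].
  by rewrite /fps_of_poly !coefX mul0r mul1r add0r /fps_divX /= subn1.
by rewrite /fps_of_poly coefX mul0r.
Qed.

Lemma fps_of_polyM p q : fps_of_poly (p * q) = fps_of_poly p * fps_of_poly q.
Proof. by apply: boolp.funext => n; rewrite fps_coefM /fps_of_poly coefM. Qed.

End Ring.

Section UnitRing.
Variable R : comUnitRingType.
Implicit Types f g : fps R.

Definition fps_unit : pred (fps R) := fun f => f 0%N \is a GRing.unit.

Definition fps_inv_step f (s : seq R) : R :=
  (f 0%N)^-1 * ((size s == 0%N)%:R - \sum_(i < size s) s`_i * f (size s - i)%N).

Definition fps_inv f : fps R :=
  if f 0%N \is a GRing.unit then fps_rec (fps_inv_step f) else f.

Fact fps_mulV : {in fps_unit, left_inverse 1 fps_inv *%R}.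
Proof.
move=> f uf; have {}uf : f 0%N \is a GRing.unit by [].
apply: boolp.funext => n; rewrite fps_coefM /fps_inv uf big_ord_recr /= subnn.
rewrite [fps_rec _ n]fps_recE /fps_inv_step size_mkseq mulrAC mulVr // mul1r.
rewrite addrCA (eq_bigr (fun i : 'I_n =>
  (mkseq (fps_rec (fps_inv_step f)) n)`_i * f (n - i)%N)) ?subrr ?addr0 //.
by move=> i _; rewrite nth_mkseq.
Qed.

Fact fps_unitP f g : g * f = 1 -> fps_unit f.
Proof.
move=> /(congr1 (fun u : fps R => u 0%N)); rewrite fps_coefM big_ord1 => gf1.
by apply/unitrPr; exists (g 0%N); rewrite mulrC.
Qed.

Fact fps_inv_out : {in [predC fps_unit], fps_inv =1 id}.
Proof. by move=> f; rewrite inE /= /fps_inv /fps_unit /in_mem /= => /negPf->. Qed.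

HB.instance Definition _ :=
  GRing.ComNzRing_hasMulInverse.Build (fps R) fps_mulV fps_unitP fps_inv_out.

(* The square root with constant term 1 of a series with constant term 1; it
   exists and is unique as soon as 2 is invertible in R, see below. *)
Definition fps_sqrt_step f (s : seq R) : R :=
  let n := size s in
  if n == 0%N then 1
  else 2%:R^-1 * (f n - \sum_(1 <= i < n) s`_i * s`_(n - i)).

Definition fps_sqrt f : fps R := fps_rec (fps_sqrt_step f).

Lemma fps_sqrt0 f : fps_sqrt f 0%N = 1.
Proof. by []. Qed.

Lemma fps_sqr_coefS f n : f 0%N = 1 ->
  (f ^+ 2) n.+1 = 2%:R * f n.+1 + \sum_(1 <= i < n.+1) f i * f (n.+1 - i)%N.
Proof.
move=> f0; rewrite expr2 fps_coefM -(big_mkord xpredT (fun i => f i * f (n.+1 - i)%N)).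
rewrite big_nat_recr //= big_nat_recl //= subn0 subnn f0 mul1r mulr1.
by rewrite big_add1 /= addrAC mulr_natl mulr2n.
Qed.

Lemma fps_sqr_sqrt f :
  2%:R \is a @GRing.unit R -> f 0%N = 1 -> fps_sqrt f ^+ 2 = f.
Proof.
move=> u2 f0; apply: boolp.funext => -[|n].
  by rewrite expr2 fps_coefM big_ord1 f0 mul1r.
rewrite fps_sqr_coefS // {1}/fps_sqrt fps_recE /fps_sqrt_step size_mkseq /=.
rewrite mulVKr // addrC -[RHS](subrK 0) subr0 addr0 addrCA -[RHS]addr0.
congr (_ + _); apply/eqP; rewrite subr_eq0; apply/eqP.
apply: eq_big_nat => i /andP[i_gt0 lt_in].
by rewrite !nth_mkseq // ltn_subrL i_gt0.
Qed.

Lemma fps_sqrt_unique f g :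
  2%:R \is a @GRing.unit R -> g 0%N = 1 -> g ^+ 2 = f -> g = fps_sqrt f.
Proof.
move=> u2 g0 g2; have f0 : f 0%N = 1 by rewrite -g2 expr2 fps_coefM big_ord1 g0 mul1r.
have s2 := fps_sqr_sqrt u2 f0.
apply: boolp.funext; elim/ltn_ind => -[_|n IHn]; first by rewrite g0.
have: (g ^+ 2) n.+1 = (fps_sqrt f ^+ 2) n.+1 by rewrite g2 s2.
rewrite !fps_sqr_coefS // (eq_big_nat _ _
  (F2 := fun i => fps_sqrt f i * fps_sqrt f (n.+1 - i)%N)).
  by move/addIr/(mulrI u2).
by move=> i /andP[i_gt0 lt_in]; rewrite !IHn // ltn_subrL i_gt0.
Qed.

End UnitRing.

(* The variables y, z, w of R[y, z, w]. *)
Definition vy (R : nzRingType) : {mpoly R[3]} := 'X_(@Ordinal 3 0 isT).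
Definition vz (R : nzRingType) : {mpoly R[3]} := 'X_(@Ordinal 3 1 isT).
Definition vw (R : nzRingType) : {mpoly R[3]} := 'X_(@Ordinal 3 2 isT).

Definition weight (a : seq nat) : {mpoly int[3]} :=
  vy int ^+ zeros a * vz int ^+ isolated_zeros a * vw int ^+ long_zero_runs a.

(* The coefficient of x^n sums over the ascent sequences of length n, which are
   enumerated through [ascent_seq_ltn]. *)
Definition F : fps {mpoly int[3]} := fun n =>
  \sum_(t : n.-tuple 'I_n |
        ascent_seq (map val t) && avoids021 (map val t)) weight (map val t).

(* The extension of scalars Z[y, z, w][[x]] -> Q[y, z, w][[x]], in which
   division by 2 makes sense. *)
Definition FQ : fps {mpoly rat[3]} := fps_map (map_mpoly intr) F.

(* Main.v *)
From HB Require Import structures.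
Require Import Defs.
From mathcomp Require Import all_boot all_order all_algebra.
From mathcomp Require Import mpoly ring zify.
From mathcomp Require boolp.
Import GRing.Theory.
Local Open Scope ring_scope.

Set Implicit Arguments.
Unset Strict Implicit.
Unset Printing Implicit Defensive.

(* A word starting with 0 avoids 021 iff its nonzero letters weakly increase.
   So the ways to complete a prefix with c ascents and largest letter m depend
   only on the slack d = c + 1 - m and on the trailing zeros. Let N_d count the
   completions after a nonzero letter, let A_d = 1 + x (N_1 + ... + N_d) count
   those after a finished run of zeros and slack d - 1, and let
   Z = xyz + x^2 y^2 w / (1 - xy) be the series of the runs of zeros. Then
   (1 - x) N_d = A_d + Z A_{d+1}, a linear recurrence on A with constant
   coefficients which, as A_0 = 1, has a single solution in power series:
   A_d = C^d with C = A_1. Hence (1 - x) (C - 1) = x (C + Z C^2). The initial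
   zeros can only be followed by 1, as if they had slack 0, so F = 1 + Z C, and
   F = (1 - x) (1 + Z) + x F^2. *)

(** * Letter-by-letter conditions on what follows the initial 0 *)

Fixpoint bounded_by_ascents (p c : nat) (s : seq nat) : bool :=
  if s is v :: s' then
    (v <= c.+1)%N && bounded_by_ascents v (c + (p < v))%N s'
  else true.

Fixpoint nonzero_nondecreasing (m : nat) (s : seq nat) : bool :=
  if s is v :: s' then
    ((v == 0) || (m <= v))%N &&
    nonzero_nondecreasing (if v == 0%N then m else v) s'
  else true.

Definition next_zeros (r : nat) : nat := if r is 0 then 1 else 2.

(* s extends a prefix of a 021-avoiding ascent sequence that has c ascents,
   ends with r zeros (r = 2 standing for any r >= 2), and whose largest letter
   is m; a prefix without nonzero letter is given m = 1, as its next nonzero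
   letter is at least 1. *)
Fixpoint extends (m c r : nat) (s : seq nat) : bool :=
  if s is v :: s' then
    if v == 0%N then extends m c (next_zeros r) s'
    else (m <= v <= c.+1)%N && extends v (c + ((0 < r) || (m < v)))%N 0 s'
  else true.

(** If [r] is 0, the prefix ends with its largest letter [m], as its nonzero letters weakly
    increase; otherwise it ends with 0. *)
Lemma extendsE m c r s : (0 < m)%N ->
  extends m c r s =
  bounded_by_ascents (if r is 0 then m else 0%N) c s &&
  nonzero_nondecreasing m s.
Proof.
elim: s m c r => [|v s IHs] m c r m_gt0 //=.
case: eqVneq => [->|v_neq0] /=.
  by rewrite addn0 IHs //; case: r.
rewrite IHs; last by rewrite lt0n.
have -> : ((if r is 0 then m else 0%N) < v)%N = (0 < r)%N || (m < v)%N.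
  by case: r => [|r] //=; rewrite lt0n.
by case: (m <= v)%N; rewrite ?andbF /= ?andbA.
Qed.

Lemma ascents_cons2 p v s i :
  ascents [:: p, v & s] i.+2 = ((p < v) + ascents (v :: s) i.+1)%N.
Proof. by rewrite /ascents /= -[1%N]addn0 iotaDl count_map. Qed.

Lemma bounded_by_ascentsP p c s :
  reflect (forall i, (i < size s)%N ->
             nth 0%N s i <= (c + ascents (p :: s) i.+1).+1)%N
          (bounded_by_ascents p c s).
Proof.
elim: s p c => [|v s IHs] p c /=; first by apply: ReflectT.
apply: (iffP andP) => [[le_v /IHs sP] [|i] lt_i|sP].
- by rewrite /ascents /= addn0.
- by rewrite ascents_cons2 addnA; apply: sP.
split; first by have := sP 0%N isT; rewrite /ascents /= addn0.
by apply/IHs => i lt_i; rewrite -addnA -ascents_cons2; apply: (sP i.+1).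
Qed.

Lemma ascent_seq_cons0 s : ascent_seq (0%N :: s) = bounded_by_ascents 0 0 s.
Proof.
rewrite /ascent_seq /=.
apply/forallP/bounded_by_ascentsP => sP => [i lt_i|[[|i] lt_i]] //=.
  by have := sP (Ordinal (lt_i : i.+1 < (size s).+1)%N).
by rewrite add1n sP.
Qed.

(** Not transitive, since 0 is related to every letter: hence [pairwise] below and not [sorted]. *)
Definition nonzero_leq (i j : nat) : bool := [|| i == 0, j == 0 | i <= j]%N.

Lemma nonzero_nondecreasingE m s : (0 < m)%N ->
  nonzero_nondecreasing m s = all (nonzero_leq m) s && pairwise nonzero_leq s.
Proof.
elim: s m => [|v s IHs] m m_gt0 //=.
have -> : nonzero_leq m v = (v == 0)%N || (m <= v)%N.
  by rewrite /nonzero_leq (gtn_eqF m_gt0).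
case: eqVneq => [->|v_neq0] /=.
  by rewrite IHs // (@eq_all _ (nonzero_leq 0) predT) ?all_predT.
rewrite IHs ?lt0n //; case: (leqP m v) => //= le_mv.
rewrite [RHS]andbCA [RHS]andbA; congr (_ && _).
apply/idP/andP=> [vP|[]//]; split=> //; apply: sub_all vP => j.
by rewrite /nonzero_leq; lia.
Qed.

Lemma all_nonzero_leq1 s : all (nonzero_leq 1) s.
Proof. by apply/allP => -[]. Qed.

(** The initial 0 turns any decreasing pair of nonzero letters into a 021, and the last two letters
    of a 021 form such a pair. *)
Lemma avoids021_cons0 s : avoids021 (0%N :: s) = nonzero_nondecreasing 1 s.
Proof.
rewrite nonzero_nondecreasingE // all_nonzero_leq1 /=.
apply/negP/(pairwiseP 0%N) => [sP i j lt_i lt_j lt_ij|sP].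
  rewrite /nonzero_leq; apply/negPn/negP; rewrite !negb_or -ltnNge => /and3P[_ j0 lt].
  have lt_i1 : (i.+1 < size (0%N :: s))%N by [].
  have lt_j1 : (j.+1 < size (0%N :: s))%N by [].
  apply: sP; apply/existsP; exists ord0; apply/existsP; exists (Ordinal lt_i1).
  by apply/existsP; exists (Ordinal lt_j1); rewrite /= ltnS lt_ij lt lt0n j0.
case/existsP=> i /existsP[[j /= lt_j]] /existsP[[k /= lt_k]] /= /and4P[ij jk ik kj].
case: j k => [|j] [|k] //= in lt_j lt_k ij jk ik kj *.
by have := sP j k lt_j lt_k jk; rewrite /nonzero_leq; lia.
Qed.

Lemma ascent_seq_avoids021_cons0 s :
  ascent_seq (0%N :: s) && avoids021 (0%N :: s) = extends 1 0 1 s.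
Proof. by rewrite ascent_seq_cons0 avoids021_cons0 extendsE. Qed.

(** * Runs of zeros, indexed by their starting positions *)

Definition leading_zeros : seq nat -> nat := find (predC1 0%N).

Lemma leading_zerosE s l :
  [&& (l <= size s)%N, all (fun j => nth 0 s j == 0)%N (iota 0 l) &
      (l == size s) || (nth 0 s l != 0)%N] = (l == leading_zeros s).
Proof.
rewrite /leading_zeros; elim: s l => [|v s IHs] [|l] //=; first by case: v.
rewrite ltnS -[1%N]addn0 iotaDl all_map eqSS.
by case: eqP => _ /=; rewrite ?andbF // -IHs.
Qed.

Lemma zero_runE a i l :
  zero_run a i l = [&& (0 < l)%N, (i == 0)%N || (nth 0 a i.-1 != 0)%N &
                       l == leading_zeros (drop i a)].
Proof.
rewrite /zero_run; case: l => //= l; case: (leqP i (size a)) => [le_i|lt_i].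
  rewrite -leading_zerosE size_drop nth_drop.
  have -> : all (fun j => nth 0 (drop i a) j == 0)%N (iota 0 l.+1) =
            all (fun j => nth 0 a j == 0)%N (iota i l.+1).
    rewrite -{2}[i]addn0 iotaDl all_map; apply: eq_all => j /=.
    by rewrite nth_drop.
  have -> : (l.+1 <= size a - i)%N = (i + l.+1 <= size a)%N by lia.
  have -> : (l.+1 == size a - i)%N = (i + l.+1 == size a)%N by lia.
  by do ?bool_congr.
rewrite (drop_oversize (ltnW lt_i)) /leading_zeros /= andbF.
by have -> : (i + l.+1 <= size a)%N = false by lia.
Qed.

(* The number of runs of zeros of s of length in L (assuming 0 is not in L);
   the boolean b tells whether a run may start at the first letter of s. *)
Definition zero_runs (L : pred nat) (b : bool) (s : seq nat) : nat :=
  \sum_(i < size s)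
    ((if i == 0%N :> nat then b else nth 0%N s i.-1 != 0%N) &&
     L (leading_zeros (drop i s))).

Lemma zero_runs_nil L b : zero_runs L b [::] = 0%N.
Proof. by rewrite /zero_runs big_ord0. Qed.

Lemma zero_runs_cons L b v s :
  zero_runs L b (v :: s) =
  ((b && L (leading_zeros (v :: s))) + zero_runs L (v != 0) s)%N.
Proof.
rewrite /zero_runs big_ord_recl /=; congr (_ + _)%N; apply: eq_bigr => i _.
by case: i => -[].
Qed.

Lemma isolated_zerosE a : isolated_zeros a = zero_runs (pred1 1%N) true a.
Proof.
rewrite /isolated_zeros -sum1_count big_mkcond -{1}[size a]subn0.
rewrite -/(index_iota 0 _) big_mkord; apply: eq_bigr => i _.
rewrite zero_runE /= [1%N == _]eq_sym; case: (leading_zeros _ == 1%N).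
  by case: (_ == 0%N :> nat) => //=; case: (_ == _).
by rewrite !andbF.
Qed.

Lemma long_zero_runsE a : long_zero_runs a = zero_runs (leq 2) true a.
Proof.
rewrite /long_zero_runs -sum1_count big_mkcond big_allpairs_dep /=.
rewrite -{1}[size a]subn0 -/(index_iota 0 _) big_mkord; apply: eq_bigr => i _.
rewrite -big_mkcond sum1_count.
set b := if _ then _ else _; set k := leading_zeros _.
transitivity (count (fun l => b && (l == k)) (iota 2 (size a).-1)).
  apply: eq_in_count => l; rewrite mem_iota zero_runE => /andP[/ltnW-> _].
  by rewrite /b; case: (_ == 0%N :> nat).
case: b; last by rewrite (@eq_count _ _ pred0) ?count_pred0.
(* A run starting at [i] can only have length [k], so the count tests whether [k] is in the
   range. *)
rewrite (@eq_count _ _ (pred1 k)) // count_uniq_mem ?iota_uniq // mem_iota /=.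
have : (k <= size a - i)%N by rewrite -size_drop find_size.
case: i k => i /= lt_i k le_k; congr nat_of_bool; lia.
Qed.

(** * Coefficients of power series *)

Section FpsRing.
Variable R : comNzRingType.

Fact fps_of_poly_additive : zmod_morphism (@fps_of_poly R).
Proof. by move=> p q; apply: boolp.funext => n; rewrite /fps_of_poly coefB. Qed.

Fact fps_of_poly_monoid_morphism : monoid_morphism (@fps_of_poly R).
Proof.
split; last exact: fps_of_polyM.
by apply: boolp.funext => n; rewrite /fps_of_poly coef1.
Qed.

HB.instance Definition _ :=
  GRing.isZmodMorphism.Build {poly R} (fps R) (@fps_of_poly R)
    fps_of_poly_additive.
HB.instance Definition _ :=
  GRing.isMonoidMorphism.Build {poly R} (fps R) (@fps_of_poly R)
    fps_of_poly_monoid_morphism.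

Lemma fps_coefD (f g : fps R) n : (f + g) n = f n + g n.
Proof. by []. Qed.

Lemma fps_coef_sum (I : Type) (r : seq I) (f : I -> fps R) n :
  (\sum_(i <- r) f i) n = \sum_(i <- r) f i n.
Proof. by elim/big_rec2: _ => // i u v _ <-. Qed.

Lemma fps_coefCM (c : R) (f : fps R) n : (fps_of_poly c%:P * f) n = c * f n.
Proof.
rewrite fps_coefM big_ord_recl subn0 big1 ?addr0 => [|i _].
  by rewrite /fps_of_poly coefC.
by rewrite /fps_of_poly coefC mul0r.
Qed.

Lemma fps_coefXM0 (f : fps R) : (fps_of_poly 'X * f) 0%N = 0.
Proof. by rewrite fps_coefM big_ord1 /fps_of_poly coefX mul0r. Qed.

Lemma fps_coefXMS (f : fps R) n : (fps_of_poly 'X * f) n.+1 = f n.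
Proof.
rewrite fps_coefM 2!big_ord_recl big1 ?addr0 => [|i _].
  by rewrite /fps_of_poly !coefX mul0r mul1r add0r subn1.
by rewrite /fps_of_poly coefX mul0r.
Qed.

End FpsRing.

(** * Weighted count of the completions of a prefix *)

Section Completions.
Variables (R : comNzRingType) (y z w : R).

Definition close_run (r : nat) : R :=
  match r with 0 => 1 | 1 => z | _ => w end.

(** For positive [r], the run left open by the prefix is counted with its full length, and [false]
    keeps the zeros heading [s] from starting a new run. *)
Definition completion_zero_runs (L : pred nat) (r : nat) (s : seq nat) : nat :=
  if r is 0 then zero_runs L true s
  else (L (r + leading_zeros s) + zero_runs L false s)%N.

(* The weight of the letters of s and of the runs of zeros that do not end
   before s, when s follows a prefix that ends with r zeros. *)
Definition completion_weight (r : nat) (s : seq nat) : R :=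
  y ^+ zeros s * z ^+ completion_zero_runs (pred1 1%N) r s *
  w ^+ completion_zero_runs (leq 2) r s.

Lemma completion_weight_nil r : completion_weight r [::] = close_run r.
Proof.
rewrite /completion_weight /completion_zero_runs /leading_zeros /=.
by rewrite !zero_runs_nil; case: r => [|[|r]] /=; rewrite ?addn0 ?mulr1 ?mul1r.
Qed.

Lemma completion_weight_long r s :
  completion_weight r.+2 s = completion_weight 2 s.
Proof. by []. Qed.

Lemma completion_weight0 r s :
  completion_weight r (0%N :: s) = y * completion_weight (next_zeros r) s.
Proof.
have -> : completion_weight (next_zeros r) s = completion_weight r.+1 s.
  by case: r => [|r] //=; rewrite (completion_weight_long r).
rewrite /completion_weight /zeros /= exprS -!mulrA; congr (_ * (_ * _)).
by case: r => [|r] /=; rewrite !zero_runs_cons /leading_zeros /= ?addnS ?addSn.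
Qed.

Lemma completion_weightS r v s : v != 0%N ->
  completion_weight r (v :: s) = close_run r * completion_weight 0 s.
Proof.
move=> v_neq0; rewrite /completion_weight /completion_zero_runs.
rewrite !zero_runs_cons /leading_zeros /zeros /= (negPf v_neq0) add0n.
by case: r => [|[|r]] /=; rewrite ?mul1r ?addn0 ?add0n ?exprS; ring.
Qed.

(* The total weight of the k-letter completions of a prefix with c ascents,
   largest letter m and r trailing zeros; by [sum_completions] it depends on c
   and m only through the slack d = c.+1 - m. *)
Fixpoint completions (k r d : nat) : R :=
  if k is k'.+1 then
    y * completions k' (next_zeros r) d +
    close_run r * ((r == 0%N)%:R * completions k' 0 d +
      \sum_(1 <= e < d + (r != 0)%N.+1) completions k' 0 e)
  else close_run r.

Lemma big_nat_sub (f : nat -> R) m n :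
  \sum_(m <= v < n) f (n - v)%N = \sum_(1 <= e < (n - m).+1) f e.
Proof.
case: (leqP n m) => [le_nm|lt_mn].
  by rewrite !big_geq //; move: le_nm; rewrite -subn_eq0 => /eqP->.
rewrite big_nat_rev -{1}[m]add0n big_addn big_add1 /= !big_mkord.
by apply: eq_bigr => i _; congr f; have := ltn_ord i; lia.
Qed.

Lemma big_tuple_cons (T : finType) k (P : pred (seq T)) (f : seq T -> R) :
  \sum_(t : k.+1.-tuple T | P t) f t =
  \sum_(v : T) \sum_(t : k.-tuple T | P (v :: t)) f (v :: t).
Proof.
rewrite pair_big_dep /= (reindex (fun p : T * k.-tuple T => cons_tuple p.1 p.2)) //=.
exists (fun t => (thead t, behead_tuple t)) => [[v t]|t] _ /=.
  by rewrite theadE; congr (_, _); apply: val_inj.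
by apply: val_inj; rewrite /= [in RHS](tuple_eta t).
Qed.

(** Each letter adds at most one ascent, so [c + k < K] persists by induction and keeps the bound
    [c.+1] on the next letter inside ['I_K]. *)
Lemma sum_completions K k m c r :
  (0 < m)%N -> (m <= c.+1)%N -> (c + k < K)%N ->
  \sum_(t : k.-tuple 'I_K | extends m c r (map val t))
     completion_weight r (map val t) = completions k r (c.+1 - m).
Proof.
elim: k m c r => [|k IHk] m c r m_gt0 le_m lt_K.
  rewrite (big_pred1 [tuple]) /= ?completion_weight_nil // => t.
  by rewrite (tuple0 t); apply/esym/eqP.
rewrite (big_tuple_cons _ (fun s => extends m c r (map val s))
          (fun s => completion_weight r (map val s))) /=.
(* [G v] is the contribution of the completions with first letter [v]; it vanishes outside 0 and the
   interval from [m] to [c.+1]. *)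
pose G v := if v == 0%N then y * completions k (next_zeros r) (c.+1 - m)
  else if (m <= v <= c.+1)%N then
    close_run r * completions k 0 ((c + ((0 < r) || (m < v))).+1 - v)%N
  else 0.
transitivity (\sum_(v < K) G v).
  apply: eq_bigr => v _; rewrite /G; case: eqVneq => [v0|v_neq0].
    rewrite v0; under eq_bigr => t _ do rewrite completion_weight0.
    by rewrite -big_distrr /= IHk //; lia.
  case: andP => [[le_mv le_v]|_]; last by rewrite big_pred0.
  under eq_bigr => t _ do rewrite completion_weightS //.
  by rewrite -big_distrr /= IHk //; lia.
rewrite -(big_mkord xpredT G) big_ltn 1?(leq_trans _ lt_K) //=.
rewrite (@big_cat_nat _ _ _ m) //=; last by lia.
rewrite (@big_cat_nat _ _ _ c.+2 m) //=; [|by lia..].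
have -> : \sum_(1 <= v < m) G v = 0.
  rewrite big_nat_cond big1 // => v; rewrite andbT /G => /andP[v1 vm].
  by rewrite gtn_eqF // leqNgt vm.
have -> : \sum_(c.+2 <= v < K) G v = 0.
  rewrite big_nat_cond big1 // => v; rewrite andbT /G => /andP[vc _].
  have -> : (v == 0%N) = false by lia.
  by have -> : (m <= v <= c.+1)%N = false by lia.
rewrite add0r addr0; congr (_ + _).
transitivity (\sum_(m <= v < c.+2)
    close_run r * completions k 0 ((c + ((0 < r) || (m < v))).+1 - v)%N).
  apply: eq_big_nat => v /andP[mv vc]; rewrite /G (gtn_eqF (leq_trans m_gt0 mv)).
  by rewrite mv -ltnS vc.
(* An ascent to [v] leaves slack [c.+2 - v]. Only [v = m] with [r = 0] is no ascent, and it keeps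
   the slack. *)
rewrite -big_distrr /=; congr (_ * _); clear G; case: r => [|r] /=.
  rewrite big_ltn // ltnn addn0 mul1r; congr (_ + _).
  rewrite addn1 -subSS -big_nat_sub.
  by apply: eq_big_nat => v /andP[mv _]; rewrite mv addn1.
by rewrite mul0r add0r addn2 -subSn // -big_nat_sub addn1.
Qed.

(** * Generating series by length, and uniqueness for the recurrence *)

Local Notation x := (fps_of_poly 'X : fps R).
Local Notation "c %:S" := (fps_of_poly c%:P) (at level 2, format "c %:S").

Definition completion_series (r d : nat) : fps R :=
  fun k => completions k r d.

Definition gap_series (d : nat) : fps R :=
  1 + x * \sum_(1 <= e < d.+1) completion_series 0 e.

Lemma gap_series0 : gap_series 0 = 1.
Proof. by rewrite /gap_series big_geq // mulr0 addr0. Qed.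

Lemma gap_seriesS d :
  gap_series d.+1 = gap_series d + x * completion_series 0 d.+1.
Proof. by rewrite /gap_series big_nat_recr //= mulrDr addrA. Qed.

Lemma completion_seriesE r d :
  completion_series r d =
  (close_run r)%:S * (gap_series (d + (r != 0%N)) +
                      (r == 0%N)%:R * x * completion_series 0 d) +
  x * (y%:S * completion_series (next_zeros r) d).
Proof.
apply: boolp.funext => k.
rewrite fps_coefD fps_coefCM /gap_series 2!fps_coefD -[_ * x * _]mulrA.
rewrite [_%:R * (x * _)]mulrCA.
case: k => [|k]; first by rewrite !fps_coefXM0 !addr0 mulr1.
rewrite !fps_coefXMS fps_coefCM fps_coef_sum /completion_series /= addnS.
have -> : (1 : fps R) k.+1 = 0 by [].
rewrite add0r addrC; congr (_ * _ + _); rewrite addrC; congr (_ + _).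
by case: (r == 0%N); rewrite ?mul1r ?mul0r.
Qed.

(** The factor [x] lets coefficient n on the right involve, besides that of [U d], only lower
    coefficients, even of [U d.+2]: induct on n, then on [d]. *)
Lemma constant_recurrence_unique (a b c : fps R) (U : nat -> fps R) :
  U 0%N = 0 ->
  (forall d, U d.+1 = U d + x * (a * U d + b * U d.+1 + c * U d.+2)) ->
  forall d, U d = 0.
Proof.
move=> U0 recU d; apply: boolp.funext => n; elim/ltn_ind: n d => n IHn.
have mul0 f d k : (k < n)%N -> (f * U d) k = 0.
  move=> lt_kn; rewrite fps_coefM big1 // => i _.
  by rewrite IHn ?mulr0 //; lia.
elim=> [|d IHd]; first by rewrite U0.
rewrite recU fps_coefD IHd [LHS]add0r.
case: n mul0 {IHn IHd} => [|n] mul0; first exact: fps_coefXM0.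
by rewrite fps_coefXMS 2!fps_coefD !mul0 // !addr0.
Qed.

End Completions.

(** * Solution of the recurrence and the quadratic equation *)

Section Equation.
Variables (R : comUnitRingType) (y z w : R).

Local Notation x := (fps_of_poly 'X : fps R).
Local Notation "c %:S" := (fps_of_poly c%:P) (at level 2, format "c %:S").
Local Notation A := (gap_series y z w).
Local Notation N := (completion_series y z w 0).
Local Notation D := (1 - x * y%:S).
(* D^-1 * Z is the generating function of the runs of zeros. *)
Local Notation Z := (x * y%:S * z%:S * D + x ^+ 2 * y%:S ^+ 2 * w%:S).

(** After two zeros a further zero changes nothing, so the series for [r = 2] is geometric with
    denominator [D]; substitute it into the equation for [r = 1]. *)
Lemma completion_series1E d :
  D * completion_series y z w 1 d = (z%:S * D + x * y%:S * w%:S) * A d.+1.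
Proof.
have := completion_seriesE y z w 1 d; have := completion_seriesE y z w 2 d.
rewrite /= addn1 mul0r mul0r addr0.
set P := completion_series _ _ _ 1 d; set Q := completion_series _ _ _ 2 d.
move=> eQ eP; have {eQ}eQ : D * Q = w%:S * A d.+1.
  by rewrite mulrBl mul1r {1}eQ; ring.
rewrite eP mulrDr [D * (x * _)]mulrCA [D * (_ * Q)]mulrCA eQ; ring.
Qed.

Lemma completion_series0E d :
  D * (1 - x) * N d = D * A d + Z * A d.+1.
Proof.
have eP := completion_series1E d; have := completion_seriesE y z w 0 d.
rewrite /= addn0 !mul1r; set P := completion_series _ _ _ 1 d in eP *.
have -> : Z * A d.+1 = x * y%:S * (D * P) by rewrite eP; ring.
have -> : fps_of_poly 1%:P = 1 :> fps R by rewrite rmorph1.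
move=> eN; have {eN}eN : (1 - x) * N d = A d + x * (y%:S * P).
  by rewrite mulrBl mul1r {1}eN; ring.
by rewrite -mulrA eN; ring.
Qed.

Lemma gap_series_recurrence d :
  A d.+1 = A d + x * (- (1 + y%:S - x * y%:S) * A d +
    (1 + y%:S - x * y%:S + D) * A d.+1 + Z * A d.+2).
Proof.
have eN := completion_series0E d.+1; have eA := gap_seriesS y z w d.
have {eN eA}e : D * (1 - x) * (A d.+1 - A d) = x * (D * A d.+1 + Z * A d.+2).
  by rewrite -eN eA; ring.
(* This uses [D * (1 - x) = 1 - x * (1 + y - x * y)]. *)
transitivity (A d + D * (1 - x) * (A d.+1 - A d) +
    x * (1 + y%:S - x * y%:S) * (A d.+1 - A d)); first by ring.
rewrite e; ring.
Qed.

Lemma gap_series_geometric d : A d.+1 = A 1 * A d.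
Proof.
apply/eqP; rewrite -subr_eq0; apply/eqP; move: d.
(* By linearity [A d.+1 - A 1 * A d] satisfies the recurrence, and it vanishes at 0. *)
apply: (constant_recurrence_unique (a := - (1 + y%:S - x * y%:S))
  (b := 1 + y%:S - x * y%:S + D) (c := Z)) => [|d].
  by rewrite gap_series0 mulr1 subrr.
by rewrite {1}gap_series_recurrence {3}[A d.+1]gap_series_recurrence; ring.
Qed.

(** The initial 0 is a prefix with [c = 0], [m = 1] and [r = 1], hence slack 0. *)
Definition ascent_series : fps R := 1 + x * (y%:S * completion_series y z w 1 0).

Lemma unit_1subXC : D \is a GRing.unit.
Proof.
have D0 : (D : fps R) 0%N = 1 - (x * y%:S) 0%N by [].
rewrite -[_ \is a _]/((D : fps R) 0%N \is a GRing.unit).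
by rewrite D0 fps_coefXM0 subr0 unitr1.
Qed.

Lemma ascent_series_quadratic :
  D * ascent_series = (1 - x) * (D + Z) + x * D * ascent_series ^+ 2.
Proof.
have eF : D * ascent_series = D + Z * A 1.
  rewrite /ascent_series mulrDr mulr1 mulrCA [D * _]mulrCA completion_series1E.
  by ring.
have eC := gap_series_recurrence 0.
rewrite gap_series0 (gap_series_geometric 1) in eC.
apply: (mulrI unit_1subXC); apply/eqP; rewrite -subr_eq0; apply/eqP.
have -> : D * ((1 - x) * (D + Z) + x * D * ascent_series ^+ 2) =
   D * (1 - x) * (D + Z) + x * (D * ascent_series) ^+ 2 by ring.
rewrite eF.
(* The difference is [Z] times the recurrence at [d = 0], where [A 2] is the square of [A 1]. *)
transitivity (Z * (A 1 - (1 + x * (- (1 + y%:S - x * y%:S) * 1 +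
  (1 + y%:S - x * y%:S + D) * A 1 + Z * (A 1 * A 1))))); first by ring.
by rewrite -eC subrr mulr0.
Qed.

(** Completing the square in the quadratic equation; the constant term 1 selects the root. *)
Lemma ascent_series_sqrt (num : fps R) :
  2%:R \is a @GRing.unit R ->
  num = D - 4%:R * x * ((1 - x) * (D + Z)) ->
  1 - x * (2%:R * ascent_series) = fps_sqrt (num / D).
Proof.
move=> unit2 numE; set f := ascent_series; apply: fps_sqrt_unique => //.
  have S0 : (1 - x * (2%:R * f)) 0%N = 1 - (x * (2%:R * f)) 0%N by [].
  by rewrite S0 fps_coefXM0 subr0.
apply: (mulIr unit_1subXC); rewrite (divrK unit_1subXC) numE.
have -> : (1 - x) * (D + Z) = D * f - x * D * f ^+ 2.
  by rewrite ascent_series_quadratic addrK.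
by ring.
Qed.

End Equation.

(** * Identification of the series and the closed form *)

Lemma FQE : FQ = ascent_series (vy rat) (vz rat) (vw rat).
Proof.
have mapX (i : 'I_3) : map_mpoly intr ('X_i : {mpoly int[3]}) = 'X_i :> {mpoly rat[3]}.
  by rewrite map_mpolyX.
have weightE s : map_mpoly intr (weight s) =
    completion_weight (vy rat) (vz rat) (vw rat) 0 s.
  rewrite /weight isolated_zerosE long_zero_runsE.
  by rewrite !rmorphM !rmorphXn /= !mapX.
apply: boolp.funext => n; rewrite /FQ /fps_map /F rmorph_sum /=.
under eq_bigr => t _ do rewrite weightE.
rewrite /ascent_series fps_coefD; case: n => [|n].
  rewrite fps_coefXM0 addr0 (big_pred1 [tuple]) /= ?completion_weight_nil //.
  have nilP : ascent_seq [::] && avoids021 [::].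
    by apply/andP; split; [apply/forallP=> -[] | apply/existsP=> -[[]]].
  by move=> t; rewrite (tuple0 t) [LHS]nilP; apply/esym/eqP.
rewrite fps_coefXMS fps_coefCM.
have -> : (1 : fps {mpoly rat[3]}) n.+1 = 0 by [].
rewrite add0r /completion_series.
have := @sum_completions _ (vy rat) (vz rat) (vw rat) n.+1 n 1 0 1.
rewrite subnn => <- //.
rewrite (big_tuple_cons _ (fun s => ascent_seq (map val s) && avoids021 (map val s))
  (fun s => completion_weight (vy rat) (vz rat) (vw rat) 0 (map val s))).
(* Only words with first letter 0 contribute. *)
rewrite big_ord_recl [X in _ + X]big1 ?addr0 => [|v _]; last first.
  by rewrite big_pred0.
rewrite mulr_sumr; apply: eq_big => [t|t _] /=.
  exact: ascent_seq_avoids021_cons0.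
by rewrite completion_weight0.
Qed.

Theorem theorem4 :
  let x : {poly {mpoly rat[3]}} := 'X in
  let y : {poly {mpoly rat[3]}} := (vy rat)%:P in
  let z : {poly {mpoly rat[3]}} := (vz rat)%:P in
  let w : {poly {mpoly rat[3]}} := (vw rat)%:P in
  let num : {poly {mpoly rat[3]}} :=
    1 - x * (4%:R + y) + 4%:R * x ^+ 2 * (1 + y * (1 - z))
    - 4%:R * x ^+ 3 * y * (1 + w * y - (1 + y) * z)
    + 4%:R * x ^+ 4 * y ^+ 2 * (w - z) in
  let den : {poly {mpoly rat[3]}} := 1 - x * y in
  FQ = fps_divX ((1 - fps_sqrt (fps_of_poly num / fps_of_poly den)) / 2%:R).
Proof.
move=> x y z w num den.
have unit2 : (2%:R : {mpoly rat[3]}) \is a GRing.unit.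
  by rewrite -[2%:R](rmorph_nat (mpolyC 3 (R:=rat))) rmorph_unit // unitfE.
have unit2S : (2%:R : fps {mpoly rat[3]}) \is a GRing.unit by [].
have denE : fps_of_poly den = 1 - fps_of_poly x * fps_of_poly y.
  by rewrite /den rmorphB rmorph1 rmorphM.
(* The numerator is the discriminant of the quadratic equation, up to a factor [den]. *)
have numE : num = den - 4%:R * x *
    ((1 - x) * (den + (x * y * z * den + x ^+ 2 * y ^+ 2 * w))).
  by rewrite /num /den; clearbody x y z w; ring.
have fps_numE : fps_of_poly num = fps_of_poly den - 4%:R * fps_of_poly x *
    ((1 - fps_of_poly x) * (fps_of_poly den +
      (fps_of_poly x * fps_of_poly y * fps_of_poly z * fps_of_poly den +
       fps_of_poly x ^+ 2 * fps_of_poly y ^+ 2 * fps_of_poly w))).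
  (* With transparent bodies, rewriting with the morphism laws diverges. *)
  rewrite numE; clearbody den x y z w.
  rewrite rmorphB 2!rmorphM rmorph_nat rmorphM rmorphB rmorphD rmorphD !rmorphM.
  by rewrite rmorph1 !expr2.
rewrite denE in fps_numE; rewrite FQE denE -(ascent_series_sqrt unit2 fps_numE).
rewrite opprB addrC subrK mulrCA [_ / _]mulrC mulKr //.
by apply: boolp.funext => n; rewrite /fps_divX fps_coefXMS.
Qed.
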